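(* Let $(\Omega,\mathcal{H},\hat{E})$ be a sublinear expectation space and let $\{Y_i\}_{i=1}^{\infty}$ be a sequence of $\mathbb{R}^d$-valued random variables in it satisfying the following conditions: (i) for every $i\ge1$, $Y_{i+1}$ is independent from $(Y_1,\ldots,Y_i)$; (ii) there exists a constant $M>0$ such that $\hat{E}[|Y_i|^2]\le M$ for all $i\ge1$; (vi) for each $i$, $\Gamma_i$ is a bounded, convex and closed subset of $\mathbb{R}^d$ such that $\hat{E}[\langle Y_i,p\rangle]=\sup_{q\in\Gamma_i}\langle q,p\rangle$ for all $p\in\mathbb{R}^d$, and $\{\Gamma_i\}$ is a Cauchy sequence in $(\Pi,d_H)$. Let $S_n=Y_1+\cdots+Y_n$. Then there exists a bounded, convex and closed subset $\Gamma$ of $\mathbb{R}^d$ such that $d_H(\Gamma,\Gamma_i)\to0$ as $i\to\infty$ and $\{S_n/n\}_{n=1}^\infty$ converges in law to the maximal distribution $N(\Gamma;0)$, i.e. $$\lim_{n\to\infty}\hat{E}\left[\varphi\left(\frac{S_n}{n}\right)\right]=\hat{E}[\varphi(\eta)]\quad\text{for all }\varphi\in C_{b,Lip}(\mathbb{R}^d),$$ where $\eta\sim N(\Gamma;0)$.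
   Context: Sublinear expectation space: $\Omega$ is a set and $\mathcal{H}$ is a linear space of real functions on $\Omega$ containing the constants, closed under $X\mapsto|X|$, and such that $\varphi(X_1,\ldots,X_n)\in\mathcal{H}$ whenever $X_1,\ldots,X_n\in\mathcal{H}$ and $\varphi\in C_{l,Lip}(\mathbb{R}^n)$. Here $C_{l,Lip}(\mathbb{R}^n)$ is the space of $\varphi:\mathbb{R}^n\to\mathbb{R}$ with $|\varphi(x)-\varphi(y)|\le C(1+|x|^m+|y|^m)|x-y|$ for all $x,y$, for some $C>0$, $m\in\mathbb{N}$ depending on $\varphi$; $C_{b,Lip}(\mathbb{R}^n)$ is the space of bounded Lipschitz functions. A sublinear expectation is a functional $\hat{E}:\mathcal{H}\to\mathbb{R}$ that is monotone ($X\ge Y\Rightarrow\hat{E}[X]\ge\hat{E}[Y]$), constant preserving ($\hat{E}[c]=c$), sub-additive ($\hat{E}[X+Y]\le\hat{E}[X]+\hat{E}[Y]$) and positively homogeneous ($\hat{E}[\lambda X]=\lambda\hat{E}[X]$, $\lambda\ge0$). An $\mathbb{R}^d$-valued random variable is an element of $\mathcal{H}^d$. Independence: $Y\in\mathcal{H}^n$ is independent from $X\in\mathcal{H}^m$ if $\hat{E}[\varphi(X,Y)]=\hat{E}\big[\hat{E}[\varphi(x,Y)]|_{x=X}\big]$ for all $\varphi\in C_{l,Lip}(\mathbb{R}^{n+m})$. $\Pi$ is the set of all (nonempty) bounded closed subsets of $\mathbb{R}^d$ and $d_H$ is the Hausdorff distance on $\Pi$ (for the Euclidean metric); the sets $\Gamma,\Gamma_i$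 are nonempty. Maximal distribution: for a bounded, convex and closed $\Gamma\subset\mathbb{R}^d$, a $d$-dimensional random vector $\eta$ is maximal distributed, $\eta\sim N(\Gamma;0)$, if $\hat{E}[\varphi(\eta)]=\max_{y\in\Gamma}\varphi(y)$ for all $\varphi\in C_{b,Lip}(\mathbb{R}^d)$. The vector $\eta$ may live on another sublinear expectation space, whose expectation is still denoted $\hat{E}$. *)

(* Defs.v *)
From HB Require Import structures.
From mathcomp Require Import all_boot all_order all_algebra.
From mathcomp Require Import all_classical all_reals all_analysis.

Set Implicit Arguments.
Unset Strict Implicit.
Unset Printing Implicit Defensive.

Import Order.TTheory GRing.Theory Num.Theory.
Import numFieldNormedType.Exports.

Local Open Scope classical_set_scope.
Local Open Scope ring_scope.

Definition inner (R : realType) (n : nat) (x y : 'rV[R]_n) : R :=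
  \sum_(j < n) x 0 j * y 0 j.

(* The library norm [`|x|] on ['rV[R]_n] is the max norm.  It defines the same
   bounded and closed sets, so [bounded_set] and [closed] are used below. *)
Definition enorm (R : realType) (n : nat) (x : 'rV[R]_n) : R :=
  Num.sqrt (inner x x).

Definition locally_lipschitz_poly (R : realType) (n : nat)
    (phi : 'rV[R]_n -> R) : Prop :=
  exists (C : R) (m : nat), 0 < C /\ forall x y : 'rV[R]_n,
    `|phi x - phi y| <= C * (1 + enorm x ^+ m + enorm y ^+ m) * enorm (x - y).

Definition bounded_lipschitz (R : realType) (n : nat)
    (phi : 'rV[R]_n -> R) : Prop :=
  (exists C : R, forall x, `|phi x| <= C) /\
  (exists L : R, forall x y, `|phi x - phi y| <= L * enorm (x - y)).

Definition coordinates_in (R : realType) (Omega : Type)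
    (H : set (Omega -> R)) (n : nat) (X : Omega -> 'rV[R]_n) : Prop :=
  forall j : 'I_n, H (fun w => X w 0 j).

(* [sl_E] is a total function, but only its values on [sl_H] are constrained
   or meaningful. *)
Record sublinear_space (R : realType) (Omega : Type) := SublinearSpace {
  sl_H : set (Omega -> R);
  sl_E : (Omega -> R) -> R;
  sl_H_cst : forall c : R, sl_H (fun=> c);
  sl_H_add : forall X Y, sl_H X -> sl_H Y -> sl_H (fun w => X w + Y w);
  sl_H_scale : forall (a : R) X, sl_H X -> sl_H (fun w => a * X w);
  sl_H_abs : forall X, sl_H X -> sl_H (fun w => `|X w|);
  sl_H_comp : forall (n : nat) (phi : 'rV[R]_n -> R) (X : Omega -> 'rV[R]_n),
    locally_lipschitz_poly phi -> coordinates_in sl_H X ->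
    sl_H (fun w => phi (X w));
  sl_E_monotone : forall X Y, sl_H X -> sl_H Y ->
    (forall w, Y w <= X w) -> sl_E Y <= sl_E X;
  sl_E_cst : forall c : R, sl_E (fun=> c) = c;
  sl_E_subadd : forall X Y, sl_H X -> sl_H Y ->
    sl_E (fun w => X w + Y w) <= sl_E X + sl_E Y;
  sl_E_poshom : forall (a : R) X, 0 <= a -> sl_H X ->
    sl_E (fun w => a * X w) = a * sl_E X
}.

Definition random_vector (R : realType) (Omega : Type)
    (S : sublinear_space R Omega) (n : nat) (X : Omega -> 'rV[R]_n) : Prop :=
  coordinates_in (sl_H S) X.

(* The relation is not symmetric: this says that [Y] is independent from [X]. *)
Definition independent_from (R : realType) (Omega : Type)
    (S : sublinear_space R Omega) (n m : nat)
    (Y : Omega -> 'rV[R]_n) (X : Omega -> 'rV[R]_m) : Prop :=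
  forall phi : 'rV[R]_(m + n) -> R, locally_lipschitz_poly phi ->
    sl_E S (fun w => phi (row_mx (X w) (Y w))) =
    sl_E S (fun w => sl_E S (fun w' => phi (row_mx (X w) (Y w')))).

(* The vector (Y 0, ..., Y (i - 1)), flattened into R^(i * d). *)
Definition prefix_vector (R : realType) (Omega : Type) (d : nat)
    (Y : nat -> Omega -> 'rV[R]_d) (i : nat) (w : Omega) : 'rV[R]_(i * d) :=
  mxvec (\matrix_(k < i, j < d) Y k w 0 j).

Definition mean (R : realType) (Omega : Type) (d : nat)
    (Y : nat -> Omega -> 'rV[R]_d) (n : nat) (w : Omega) : 'rV[R]_d :=
  n%:R^-1 *: \sum_(i < n) Y i w.

(* Membership in the collection Pi on which the Hausdorff distance is used. *)
Definition nonempty_bounded_closed (R : realType) (d : nat)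
    (A : set 'rV[R]_d) : Prop :=
  [/\ A !=set0, bounded_set A & closed A].

Definition convex_in (R : realType) (d : nat) (A : set 'rV[R]_d) : Prop :=
  convex_set (A : set (convex_lmodType 'rV[R]_d)).

Definition dist_to (R : realType) (d : nat) (x : 'rV[R]_d)
    (B : set 'rV[R]_d) : R :=
  inf [set enorm (x - y) | y in B].

(* Meaningful only for nonempty bounded sets, because the real-valued [sup] and
   [inf] are 0 on sets that are empty or unbounded on the relevant side. *)
Definition hausdorff_dist (R : realType) (d : nat) (A B : set 'rV[R]_d) : R :=
  Num.max (sup [set dist_to x B | x in A]) (sup [set dist_to y A | y in B]).

Definition hausdorff_cauchy (R : realType) (d : nat)
    (G : nat -> set 'rV[R]_d) : Prop :=
  (forall i, nonempty_bounded_closed (G i)) /\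
  (forall eps : R, 0 < eps -> exists N : nat, forall i j : nat,
    (N <= i)%N -> (N <= j)%N -> hausdorff_dist (G i) (G j) < eps).

Definition is_max (R : realType) (A : set R) (v : R) : Prop :=
  A v /\ ubound A v.

(* eta ~ N(G; 0) *)
Definition maximal_distributed (R : realType) (Omega : Type)
    (S : sublinear_space R Omega) (d : nat) (G : set 'rV[R]_d)
    (eta : Omega -> 'rV[R]_d) : Prop :=
  random_vector S eta /\
  forall phi : 'rV[R]_d -> R, bounded_lipschitz phi ->
    is_max [set phi y | y in G] (sl_E S (fun w => phi (eta w))).

(* The limit vector may live on a different sublinear expectation space. *)
Definition converges_in_law (R : realType) (Omega Omega' : Type)
    (S : sublinear_space R Omega) (S' : sublinear_space R Omega') (d : nat)
    (Z : nat -> Omega -> 'rV[R]_d) (eta : Omega' -> 'rV[R]_d) : Prop :=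
  forall phi : 'rV[R]_d -> R, bounded_lipschitz phi ->
    (fun n => sl_E S (fun w => phi (Z n w))) @ \oo -->
    sl_E S' (fun w => phi (eta w)).

(* Main.v *)
Require Import Defs.
From HB Require Import structures.
From mathcomp Require Import all_boot all_order all_algebra.
From mathcomp Require Import all_classical all_reals all_analysis.
From mathcomp Require Import ring lra.

(* The limit set is the set of points whose distance to the G i tends to 0; it
   is Hausdorff close to each late G i because a choice of nearby points
   q_j in G j has a cluster point.

   For the law of large numbers put A_n = G 0 + ... + G (n - 1) (Minkowski sum)
   and S_n = Y 0 + ... + Y (n - 1).  For a in A_n and q in G n, expanding
   |x + Y n - (a + q)|^2 around u = x - a produces the cross term
   2 (E<Y n, u> - <q, u>), which is nonnegative and, q being free, has infimum
   0.  Hence each step adds at most 4 M to E[dist(S_n, A_n)^2], so this quantity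
   is at most 4 M n, and dually E[- |S_n - c|^2] >= - 4 M n for every selection
   sum c in A_n.  Dividing by n^2 leaves O(1/n).  Finally A_n / n is within the
   Cesaro mean of the Hausdorff distances from the limit set: convexity gives
   this for every point of A_n / n, and for a given point of the limit set one
   uses a selection sum close to its multiple.  These are respectively the upper
   and the lower bound for E[phi(S_n / n)]. *)

Set Implicit Arguments.
Unset Strict Implicit.
Unset Printing Implicit Defensive.

Import Order.TTheory GRing.Theory Num.Theory.
Import numFieldNormedType.Exports.

Local Open Scope classical_set_scope.
Local Open Scope ring_scope.

(** * Euclidean inner product and norm *)

Lemma innerC (R : realType) (n : nat) (x y : 'rV[R]_n) : inner x y = inner y x.
Proof. by apply: eq_bigr => j _; rewrite mulrC. Qed.

Lemma innerDl (R : realType) (n : nat) (x y z : 'rV[R]_n) :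
  inner (x + y) z = inner x z + inner y z.
Proof. by rewrite -big_split; apply: eq_bigr => j _; rewrite mxE mulrDl. Qed.

Lemma innerZl (R : realType) (n : nat) (a : R) (x y : 'rV[R]_n) :
  inner (a *: x) y = a * inner x y.
Proof. by rewrite /inner mulr_sumr; apply: eq_bigr => j _; rewrite mxE mulrA. Qed.

Lemma innerNl (R : realType) (n : nat) (x y : 'rV[R]_n) :
  inner (- x) y = - inner x y.
Proof. by rewrite -scaleN1r innerZl mulN1r. Qed.

Lemma innerDr (R : realType) (n : nat) (x y z : 'rV[R]_n) :
  inner z (x + y) = inner z x + inner z y.
Proof. by rewrite innerC innerDl !(innerC z). Qed.

Lemma innerZr (R : realType) (n : nat) (a : R) (x y : 'rV[R]_n) :
  inner x (a *: y) = a * inner x y.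
Proof. by rewrite innerC innerZl innerC. Qed.

Lemma innerNr (R : realType) (n : nat) (x y : 'rV[R]_n) :
  inner x (- y) = - inner x y.
Proof. by rewrite innerC innerNl innerC. Qed.

Definition innerE := (innerDl, innerDr, innerNl, innerNr, innerZl, innerZr).

Lemma inner_ge0 (R : realType) (n : nat) (x : 'rV[R]_n) : 0 <= inner x x.
Proof. by apply: sumr_ge0 => j _; rewrite -expr2 sqr_ge0. Qed.

Lemma enorm_ge0 (R : realType) (n : nat) (x : 'rV[R]_n) : 0 <= enorm x.
Proof. exact: sqrtr_ge0. Qed.

Lemma enorm_sq (R : realType) (n : nat) (x : 'rV[R]_n) :
  enorm x ^+ 2 = inner x x.
Proof. by rewrite sqr_sqrtr ?inner_ge0. Qed.

Lemma inner0l (R : realType) (n : nat) (x : 'rV[R]_n) : inner 0 x = 0.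
Proof. by rewrite /inner big1 // => j _; rewrite mxE mul0r. Qed.

Lemma enorm0 (R : realType) (n : nat) : enorm (0 : 'rV[R]_n) = 0.
Proof. by rewrite /enorm inner0l sqrtr0. Qed.

Lemma enormZ (R : realType) (n : nat) (a : R) (x : 'rV[R]_n) :
  enorm (a *: x) = `|a| * enorm x.
Proof.
by rewrite /enorm innerZl innerZr mulrA -expr2 sqrtrM ?sqr_ge0 // sqrtr_sqr.
Qed.

Lemma enormN (R : realType) (n : nat) (x : 'rV[R]_n) : enorm (- x) = enorm x.
Proof. by rewrite -scaleN1r enormZ normrN1 mul1r. Qed.

Lemma enormB (R : realType) (n : nat) (x y : 'rV[R]_n) :
  enorm (x - y) = enorm (y - x).
Proof. by rewrite -enormN opprB. Qed.

Lemma coord_le_enorm (R : realType) (n : nat) (x : 'rV[R]_n) (j : 'I_n) :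
  `|x 0 j| <= enorm x.
Proof.
rewrite -sqrtr_sqr ler_wsqrtr // /inner (bigD1 j) //= -expr2 lerDl.
by apply: sumr_ge0 => i _; rewrite -expr2 sqr_ge0.
Qed.

Lemma enorm_eq0 (R : realType) (n : nat) (x : 'rV[R]_n) : enorm x = 0 -> x = 0.
Proof.
move=> x0; apply/rowP => j; rewrite mxE; apply/eqP.
by rewrite -normr_le0 -x0 coord_le_enorm.
Qed.

(** Cauchy-Schwarz: the square of the norm of [|y| x - |x| y] equals [2 |x| |y| (|x| |y| - <x, y>)]
    and is nonnegative. Zero vectors are set apart because the positive factor is cancelled. *)
Lemma inner_le_enorm (R : realType) (n : nat) (x y : 'rV[R]_n) :
  inner x y <= enorm x * enorm y.
Proof.
have [/enorm_eq0 ->|x0] := eqVneq (enorm x) 0; first by rewrite inner0l enorm0 mul0r.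
have [/enorm_eq0 ->|y0] := eqVneq (enorm y) 0.
  by rewrite innerC inner0l enorm0 mulr0.
have xy : 0 < 2 * (enorm x * enorm y).
  by rewrite mulr_gt0 // mulr_gt0 // lt_neqAle eq_sym ?x0 ?y0 enorm_ge0.
have := inner_ge0 (enorm y *: x - enorm x *: y).
rewrite !innerE -!enorm_sq (innerC y x) => h.
rewrite -subr_ge0 -(pmulr_rge0 _ xy); apply: le_trans h _.
by rewrite le_eqVlt; apply/orP; left; apply/eqP; ring.
Qed.

Lemma enormD (R : realType) (n : nat) (x y : 'rV[R]_n) :
  enorm (x + y) <= enorm x + enorm y.
Proof.
rewrite -(ler_pXn2r (n := 2)) // ?nnegrE ?addr_ge0 ?enorm_ge0 //.
rewrite enorm_sq !innerE (innerC y x) sqrrD !enorm_sq.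
by have := inner_le_enorm x y; lra.
Qed.

Lemma enormDB (R : realType) (n : nat) (z x y : 'rV[R]_n) :
  enorm (x - y) <= enorm (x - z) + enorm (z - y).
Proof. by have := enormD (x - z) (z - y); rewrite addrA subrK. Qed.

Lemma enorm_sum (R : realType) (n : nat) (I : Type) (r : seq I)
    (F : I -> 'rV[R]_n) :
  enorm (\sum_(i <- r) F i) <= \sum_(i <- r) enorm (F i).
Proof.
elim/big_rec2: _ => [|i a x _ h]; first by rewrite enorm0.
by rewrite (le_trans (enormD _ _)) // lerD2l.
Qed.

Lemma enorm_le_sum (R : realType) (n : nat) (x : 'rV[R]_n) :
  enorm x <= \sum_(j < n) `|x 0 j|.
Proof.
rewrite [X in enorm X]row_sum_delta (le_trans (enorm_sum _ _)) //.
apply: ler_sum => j _; rewrite enormZ.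
suff -> : enorm (delta_mx 0 j : 'rV[R]_n) = 1 by rewrite mulr1.
rewrite /enorm /inner (bigD1 j) //= big1 ?addr0; first by rewrite !mxE !eqxx mulr1 sqrtr1.
by move=> i /negbTE ij; rewrite !mxE ij andbF mulr0.
Qed.

Lemma enorm_mulmx (R : realType) (m n : nat) (A : 'M[R]_(m, n)) :
  exists2 K : R, 0 <= K & forall x : 'rV[R]_m, enorm (x *m A) <= K * enorm x.
Proof.
exists (\sum_(j < n) \sum_(i < m) `|A i j|) => [|x].
  by do 2 (apply: sumr_ge0 => ? _).
rewrite (le_trans (enorm_le_sum _)) // mulr_suml; apply: ler_sum => j _.
rewrite mxE (le_trans (ler_norm_sum _ _ _)) // mulr_suml; apply: ler_sum => i _.
by rewrite normrM mulrC ler_wpM2l // coord_le_enorm.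
Qed.

(** * Comparison of the Euclidean norm with the library norm and topology *)

Lemma norm_le_enorm (R : realType) (n : nat) (x : 'rV[R]_n) : `|x| <= enorm x.
Proof.
rewrite [`|x|]mx_normrE; apply/bigmax_leP; split=> [|[i j] _ /=].
  exact: enorm_ge0.
by rewrite ord1 coord_le_enorm.
Qed.

Lemma enorm_le_norm (R : realType) (n : nat) (x : 'rV[R]_n) :
  enorm x <= n%:R * `|x|.
Proof.
rewrite (le_trans (enorm_le_sum _)) // mulr_natl -[X in _ *+ X](card_ord n).
rewrite -sumr_const.
apply: ler_sum => j _; rewrite [`|x|]mx_normrE.
exact: (le_bigmax _ (fun ij : 'I_1 * 'I_n => `|x ij.1 ij.2|) (0, j)).
Qed.

Lemma bounded_setP (R : realType) (n : nat) (A : set 'rV[R]_n) :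
  bounded_set A <-> exists K : R, forall x, A x -> enorm x <= K.
Proof.
split=> [[K [_ /(_ (K + 1))]]|[K hK]].
  rewrite ltrDl ltr01 => /(_ isT) h; exists (n%:R * (K + 1)) => x Ax.
  by rewrite (le_trans (enorm_le_norm _)) // ler_wpM2l // h.
exists K; split; first exact: num_real.
move=> L KL x Ax; apply: (le_trans (norm_le_enorm x)).
by rewrite (le_trans (hK _ Ax)) // ltW.
Qed.

Lemma nbhs_enorm (R : realType) (n : nat) (x : 'rV[R]_n) (e : R) : 0 < e ->
  nbhs x [set y | enorm (x - y) < e].
Proof.
move=> e0; have e1 : 0 < e / n.+1%:R by rewrite divr_gt0.
near=> y; rewrite /= (le_lt_trans (enorm_le_norm _)) //.
have : `|x - y| < e / n.+1%:R by near: y; exact: cvgr_dist_lt.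
rewrite ltr_pdivlMr // mulrC => /(le_lt_trans _); apply.
by rewrite ler_wpM2r // ler_nat.
Unshelve. all: by end_near. Qed.

Lemma closed_enormP (R : realType) (n : nat) (A : set 'rV[R]_n) :
  (forall x, (forall e : R, 0 < e -> exists2 y, A y & enorm (x - y) < e) ->
     A x) -> closed A.
Proof.
move=> h; apply/closure_id; rewrite eqEsubset; split; first exact: subset_closure.
move=> x clx; apply: h => e e0.
by have [y [Ay ye]] := clx _ (nbhs_enorm x e0); exists y.
Qed.

(** * Distance to a set and Hausdorff distance *)

Lemma dist_to_has_inf (R : realType) (n : nat) (x : 'rV[R]_n)
    (A : set 'rV[R]_n) :
  A !=set0 -> has_inf [set enorm (x - y) | y in A].
Proof.
move=> [a Aa]; split; first by exists (enorm (x - a)), a.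
by exists 0 => _ [y _ <-]; exact: enorm_ge0.
Qed.

Lemma dist_to_le (R : realType) (n : nat) (x y : 'rV[R]_n) (A : set 'rV[R]_n) :
  A y -> dist_to x A <= enorm (x - y).
Proof.
move=> Ay; apply: ge_inf; last by exists y.
by have [] := @dist_to_has_inf R n x A (ex_intro _ y Ay).
Qed.

Lemma dist_to_ge (R : realType) (n : nat) (x : 'rV[R]_n) (A : set 'rV[R]_n)
    (c : R) :
  A !=set0 -> (forall y, A y -> c <= enorm (x - y)) -> c <= dist_to x A.
Proof.
move=> A0 h; apply: lb_le_inf; first by have [] := dist_to_has_inf x A0.
by move=> _ [y Ay <-]; exact: h.
Qed.

Lemma dist_to_ge0 (R : realType) (n : nat) (x : 'rV[R]_n) (A : set 'rV[R]_n) :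
  A !=set0 -> 0 <= dist_to x A.
Proof. by move=> A0; apply: dist_to_ge => // y _; exact: enorm_ge0. Qed.

Lemma dist_to_lt (R : realType) (n : nat) (x : 'rV[R]_n) (A : set 'rV[R]_n)
    (c : R) :
  A !=set0 -> dist_to x A < c -> exists2 y, A y & enorm (x - y) < c.
Proof.
move=> A0; rewrite -subr_gt0 => /inf_adherent/(_ (dist_to_has_inf x A0)).
move=> [_ [y Ay <-]]; rewrite -/(dist_to x A) (addrC (dist_to x A)) subrK => yc; by exists y.
Qed.

Lemma dist_to_lipschitz (R : realType) (n : nat) (x y : 'rV[R]_n)
    (A : set 'rV[R]_n) :
  A !=set0 -> dist_to x A <= enorm (x - y) + dist_to y A.
Proof.
move=> A0; rewrite -lerBlDl; apply: dist_to_ge => // a Aa.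
by rewrite lerBlDl (le_trans (dist_to_le x Aa)) // enormDB.
Qed.

Lemma hausdorff_distC (R : realType) (n : nat) (A B : set 'rV[R]_n) :
  hausdorff_dist A B = hausdorff_dist B A.
Proof. exact: maxC. Qed.

(** Boundedness of [A] makes the distances to [B] bounded above, so that the real-valued [sup] is a
    true upper bound and not its default value. *)
Lemma dist_to_le_hausdorff (R : realType) (n : nat) (A B : set 'rV[R]_n)
    (x : 'rV[R]_n) :
  bounded_set A -> B !=set0 -> A x -> dist_to x B <= hausdorff_dist A B.
Proof.
move=> /bounded_setP[K AK] [b Bb] Ax; rewrite /hausdorff_dist le_max.
apply/orP; left; apply: ub_le_sup; last by exists x.
exists (K + enorm b) => _ [y Ay <-]; rewrite (le_trans (dist_to_le y Bb)) //.
by rewrite (le_trans (enormD _ _)) // enormN lerD2r AK.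
Qed.

Lemma hausdorff_dist_le (R : realType) (n : nat) (A B : set 'rV[R]_n) (e : R) :
  A !=set0 -> B !=set0 -> (forall x, A x -> dist_to x B <= e) ->
  (forall y, B y -> dist_to y A <= e) -> hausdorff_dist A B <= e.
Proof.
move=> [a Aa] [b Bb] hA hB; rewrite ge_max; apply/andP; split; apply: ge_sup.
- by exists (dist_to a B), a.
- by move=> _ [x Ax <-]; exact: hA.
- by exists (dist_to b A), b.
- by move=> _ [y By <-]; exact: hB.
Qed.

Lemma hausdorff_dist_ge0 (R : realType) (n : nat) (A B : set 'rV[R]_n) :
  bounded_set A -> A !=set0 -> B !=set0 -> 0 <= hausdorff_dist A B.
Proof.
move=> bA [a Aa] B0; rewrite (le_trans (dist_to_ge0 a B0)) //.
exact: dist_to_le_hausdorff.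
Qed.

(** * The limit of a Hausdorff Cauchy sequence, taken as the Kuratowski lower limit *)

Definition limit_set (R : realType) (n : nat) (G : nat -> set 'rV[R]_n) :
  set 'rV[R]_n :=
  [set x | forall e : R, 0 < e ->
     exists N, forall i, (N <= i)%N -> dist_to x (G i) < e].

Lemma limit_set_closed (R : realType) (n : nat) (G : nat -> set 'rV[R]_n) :
  (forall i, G i !=set0) -> closed (limit_set G).
Proof.
move=> G0; apply: closed_enormP => x h e e0.
have e2 : 0 < e / 2 by rewrite divr_gt0.
have [y /(_ _ e2)[N yN] xy] := h _ e2.
exists N => i /yN yi; rewrite (le_lt_trans (dist_to_lipschitz x y (G0 i))) //.
by rewrite [e]splitr ltrD.
Qed.

Lemma convex_inP (R : realType) (n : nat) (A : set 'rV[R]_n) :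
  convex_in A <-> forall (x y : 'rV[R]_n) (t : R), 0 <= t <= 1 -> A x -> A y ->
    A (t *: x + (1 - t) *: y).
Proof.
split=> [cA x y t t01 Ax Ay|cA x y t].
  have [t0 t1] := andP t01.
  have h := cA x y (Itv01 t0 t1); rewrite !inE in h.
  exact: h.
rewrite !inE => Ax Ay; apply: cA => //.
by apply/andP; split.
Qed.

Lemma limit_set_convex (R : realType) (n : nat) (G : nat -> set 'rV[R]_n) :
  (forall i, G i !=set0) -> (forall i, convex_in (G i)) ->
  convex_in (limit_set G).
Proof.
move=> G0 cG; apply/convex_inP => x y t /[dup] t01 /andP[t0 t1] hx hy e e0.
have [N xN] := hx _ e0; have [N' yN] := hy _ e0.
exists (maxn N N') => i; rewrite geq_max => /andP[/xN xi /yN yi].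
have [a Ga xa] := dist_to_lt (G0 i) xi; have [b Gb yb] := dist_to_lt (G0 i) yi.
have Gab := (convex_inP (G i)).1 (cG i) _ _ _ t01 Ga Gb.
apply: (le_lt_trans (dist_to_le _ Gab)).
have -> : t *: x + (1 - t) *: y - (t *: a + (1 - t) *: b) =
    t *: (x - a) + (1 - t) *: (y - b).
  by rewrite !scalerBr opprD addrACA.
rewrite (le_lt_trans (enormD _ _)) // !enormZ ger0_norm // ger0_norm ?subr_ge0 //.
(* Strictness is taken from the [x] term, whose weight may vanish; for [t = 0] it comes from the
   bound on [y - b]. *)
have [->|tn0] := eqVneq t 0; first by lra.
have : t * enorm (x - a) < t * e by rewrite ltr_pM2l // lt_neqAle eq_sym tn0.
have : (1 - t) * enorm (y - b) <= (1 - t) * e by rewrite ler_wpM2l ?subr_ge0 // ltW.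
lra.
Qed.

(** Points [q_ j] of [G j] within [e] of [q] stay in a compact ball, hence have a cluster point
    there. The Cauchy property makes this point close to all late sets, although only some of the
    [q_ j] come near it. *)
Lemma limit_set_near (R : realType) (n : nat) (G : nat -> set 'rV[R]_n)
    (e : R) (N : nat) :
  hausdorff_cauchy G ->
  (forall i j, (N <= i)%N -> (N <= j)%N -> hausdorff_dist (G i) (G j) < e) ->
  forall i q, (N <= i)%N -> G i q -> exists2 x, limit_set G x & enorm (q - x) <= e.
Proof.
move=> [Gnbc Gc] GN i q Ni Giq.
(* The condition [N <= j] is kept inside the existential so that [choice] yields a total sequence;
   indices below [N] get the dummy value 0. *)
have pick j : exists y, (N <= j)%N -> G j y /\ enorm (q - y) < e.
  have [Nj|/negP Nj] := boolP (N <= j)%N; last by exists 0.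
  have [_ bi _] := Gnbc i; have [j0 _ _] := Gnbc j.
  have [y Gy qy] := dist_to_lt j0
    (le_lt_trans (dist_to_le_hausdorff bi j0 Giq) (GN _ _ Ni Nj)).
  by exists y.
have [q_ q_P] := choice pick.
pose A := [set z : 'rV[R]_n | enorm (q - z) <= e].
have bA : bounded_set A.
  apply/bounded_setP; exists (enorm q + e) => z qz.
  have := enormDB q z 0; rewrite !subr0 (enormB z q) => h.
  by rewrite (le_trans h) // addrC lerD2l.
have cA : closed A.
  apply: closed_enormP => z h; apply/ler_addgt0Pr => d d0.
  have [y Ay zy] := h _ d0.
  by rewrite (le_trans (enormDB y q z)) // lerD // enormB ltW.
have FA : (q_ @ \oo) A.
  by exists N => // j /q_P[_ /ltW].
have [x [Ax clx]] := bounded_closed_compact bA cA _ FA.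
exists x => // d d0.
have d2 : 0 < d / 2 by rewrite divr_gt0.
have [N' GN'] := Gc _ d2.
exists N' => j N'j.
(* Clustering along this tail gives an index [k] beyond both [N] and [N']: the first puts [q_ k] in
   [G k], the second makes [G k] close to [G j]. *)
have Fq : (q_ @ \oo) [set q_ k | k in [set k | (maxn N N' <= k)%N]].
  by exists (maxn N N') => // k /= hk; exists k.
have [_ [[k /= hk <-] xk]] := clx _ _ Fq (nbhs_enorm x d2).
move: hk; rewrite geq_max => /andP[Nk N'k].
have [Gk _] := q_P k Nk.
have [_ bk _] := Gnbc k; have [j0 _ _] := Gnbc j.
rewrite (le_lt_trans (dist_to_lipschitz x (q_ k) j0)) // [d]splitr ltrD //.
exact: le_lt_trans (dist_to_le_hausdorff bk j0 Gk) (GN' _ _ N'k N'j).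
Qed.

Lemma limit_set_nbc (R : realType) (n : nat) (G : nat -> set 'rV[R]_n) :
  hausdorff_cauchy G -> nonempty_bounded_closed (limit_set G).
Proof.
move=> /[dup] Gc [Gnbc /(_ 1 ltr01)[N GN]].
have G0 i : G i !=set0 by have [] := Gnbc i.
have [[q Gq] bN _] := Gnbc N; split.
- by have [x hx _] := limit_set_near Gc GN (leqnn N) Gq; exists x.
- have /bounded_setP[K GK] := bN; apply/bounded_setP.
  (* Two jumps of length below 1, from [x] to some late [G j] and from there to [G N], end inside
     the bound [K] of [G N]. *)
  exists (1 + (1 + K)) => x /(_ _ ltr01)[N' xN'].
  pose j := maxn N N'.
  have [y Gy xy] := dist_to_lt (G0 j) (xN' j (leq_maxr _ _)).
  have [_ bj _] := Gnbc j.
  have [z Gz yz] := dist_to_lt (G0 N) (le_lt_trans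
    (dist_to_le_hausdorff bj (G0 N) Gy) (GN _ _ (leq_maxl _ _) (leqnn N))).
  rewrite -[x](subrK y) (le_trans (enormD _ _)) // lerD ?(ltW xy) //.
  rewrite -[y](subrK z) (le_trans (enormD _ _)) // lerD ?GK //; exact: ltW.
- exact: limit_set_closed.
Qed.

Lemma hausdorff_limit_set (R : realType) (n : nat) (G : nat -> set 'rV[R]_n) :
  hausdorff_cauchy G -> (fun i => hausdorff_dist (limit_set G) (G i)) @ \oo --> 0.
Proof.
move=> /[dup] Gc [Gnbc Ge]; have [L0 bL _] := limit_set_nbc Gc.
have G0 i : G i !=set0 by have [] := Gnbc i.
apply/cvgrPdist_le => e e0.
have e2 : 0 < e / 2 by rewrite divr_gt0.
have [N GN] := Ge _ e2; exists N => // i /= Ni.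
rewrite sub0r normrN ger0_norm ?hausdorff_dist_ge0 //.
apply: hausdorff_dist_le => // [x /(_ _ e2)[N' xN']|y Gy].
  pose j := maxn N N'.
  have [y Gy xy] := dist_to_lt (G0 j) (xN' j (leq_maxr _ _)).
  have [_ bj _] := Gnbc j.
  rewrite (le_trans (dist_to_lipschitz x y (G0 i))) // [e]splitr lerD ?(ltW xy) //.
  rewrite (le_trans (dist_to_le_hausdorff bj (G0 i) Gy)) // ltW // GN //.
  exact: leq_maxl.
have [x Lx yx] := limit_set_near Gc GN Ni Gy.
rewrite (le_trans (dist_to_le y Lx)) // (le_trans yx) //; lra.
Qed.

(** * Sublinear expectation and test functions of quadratic growth *)

Lemma sl_H_opp (R : realType) (Omega : Type) (S : sublinear_space R Omega)
    (X : Omega -> R) :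
  sl_H S X -> sl_H S (fun w => - X w).
Proof.
by move=> /(sl_H_scale (-1)); congr sl_H; apply/funext => w; rewrite mulN1r.
Qed.

Lemma sl_E_leD (R : realType) (Omega : Type) (S : sublinear_space R Omega)
    (X Y Z : Omega -> R) :
  sl_H S X -> sl_H S Y -> sl_H S Z -> (forall w, X w <= Y w + Z w) ->
  sl_E S X <= sl_E S Y + sl_E S Z.
Proof.
move=> HX HY HZ le; apply: le_trans (sl_E_subadd HY HZ).
by apply: sl_E_monotone => //; exact: sl_H_add.
Qed.

Lemma sl_E_leDc (R : realType) (Omega : Type) (S : sublinear_space R Omega)
    (X Y : Omega -> R) (c : R) :
  sl_H S X -> sl_H S Y -> (forall w, X w <= Y w + c) ->
  sl_E S X <= sl_E S Y + c.
Proof.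
move=> HX HY le; rewrite -[X in _ <= _ + X](sl_E_cst S c).
by apply: sl_E_leD => //; exact: sl_H_cst.
Qed.

(** The case [m = 1] of [locally_lipschitz_poly]. It contains the rescaled bounded Lipschitz
    functions and the squared distances, and it is stable under linear substitution and under
    integrating out one summand. *)
Definition quad_lipschitz (R : realType) (n : nat) (f : 'rV[R]_n -> R) :=
  exists2 C : R, 0 <= C & forall x y,
    `|f x - f y| <= C * (1 + enorm x + enorm y) * enorm (x - y).

Lemma quad_lipschitz_poly (R : realType) (n : nat) (f : 'rV[R]_n -> R) :
  quad_lipschitz f -> locally_lipschitz_poly f.
Proof.
move=> [C C0 h]; exists (C + 1), 1%N; split=> [|x y].
  by rewrite ltr_wpDl.
rewrite (le_trans (h x y)) // ler_wpM2r ?enorm_ge0 // !expr1.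
by rewrite ler_wpM2r ?addr_ge0 ?enorm_ge0 // lerDl.
Qed.

Lemma quad_lipschitz_mulmx (R : realType) (m n : nat) (A : 'M[R]_(m, n))
    (f : 'rV[R]_n -> R) :
  quad_lipschitz f -> quad_lipschitz (fun x => f (x *m A)).
Proof.
move=> [C C0 h]; have [K K0 AK] := enorm_mulmx A.
exists (C * (1 + K) * K) => [|x y]; first by rewrite !mulr_ge0 ?addr_ge0.
rewrite (le_trans (h _ _)) // -mulmxBl.
have -> : C * (1 + K) * K * (1 + enorm x + enorm y) * enorm (x - y) =
  C * ((1 + K) * (1 + enorm x + enorm y)) * (K * enorm (x - y)) by ring.
have ex := enorm_ge0 x; have ey := enorm_ge0 y.
apply: ler_pM => //; rewrite ?enorm_ge0 //.
  by rewrite mulr_ge0 // !addr_ge0 ?enorm_ge0.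
rewrite ler_wpM2l //; have := AK x; have := AK y.
nra.
Qed.

Lemma bounded_lipschitz_quad (R : realType) (n : nat) (f : 'rV[R]_n -> R)
    (a : R) :
  bounded_lipschitz f -> quad_lipschitz (fun x => f (a *: x)).
Proof.
move=> [_ [L h]]; exists (`|L| * `|a|) => [|x y]; first exact: mulr_ge0.
rewrite (le_trans (h _ _)) // -scalerBr enormZ mulrA.
rewrite ler_wpM2r ?enorm_ge0 // (@le_trans _ _ (`|L| * `|a|)) //.
  by rewrite ler_wpM2r // ler_norm.
by rewrite ler_peMr ?mulr_ge0 // -addrA lerDl addr_ge0 ?enorm_ge0.
Qed.

Lemma quad_lipschitz_opp (R : realType) (n : nat) (f : 'rV[R]_n -> R) :
  quad_lipschitz f -> quad_lipschitz (fun x => - f x).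
Proof.
by move=> [C C0 h]; exists C => // x y; rewrite -opprD normrN.
Qed.

(** Factor the difference of squares: the distance is 1-Lipschitz, and the sum of the two distances
    is at most [|x| + |y| + 2 |a|] for a fixed [a] in [A]. *)
Lemma quad_lipschitz_dist_sq (R : realType) (n : nat) (A : set 'rV[R]_n) :
  A !=set0 -> quad_lipschitz (fun x => dist_to x A ^+ 2).
Proof.
move=> /[dup] A0 [a Aa]; have ea := enorm_ge0 a.
exists (2 * (1 + enorm a)) => [|x y]; first by lra.
have ex := enorm_ge0 x; have ey := enorm_ge0 y.
have dle z : dist_to z A <= enorm z + enorm a.
  by rewrite (le_trans (dist_to_le z Aa)) // (le_trans (enormD _ _)) // enormN.
have [dx dy] := (dle x, dle y).
have [x0 y0] := (dist_to_ge0 x A0, dist_to_ge0 y A0).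
have lip : `|dist_to x A - dist_to y A| <= enorm (x - y).
  rewrite ler_norml; have := dist_to_lipschitz x y A0.
  have := dist_to_lipschitz y x A0; rewrite (enormB y); lra.
rewrite subr_sqr normrM mulrC ler_pM //.
rewrite ger0_norm ?addr_ge0 //; nra.
Qed.

Lemma quad_lipschitz_H (R : realType) (Omega : Type)
    (S : sublinear_space R Omega) (n : nat) (f : 'rV[R]_n -> R)
    (X : Omega -> 'rV[R]_n) :
  quad_lipschitz f -> random_vector S X -> sl_H S (fun w => f (X w)).
Proof. by move=> /quad_lipschitz_poly hf hX; exact: sl_H_comp. Qed.

Lemma random_vector_cst (R : realType) (Omega : Type)
    (S : sublinear_space R Omega) (n : nat) (x : 'rV[R]_n) :
  random_vector S (fun=> x).
Proof. by move=> j; exact: sl_H_cst. Qed.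

Lemma random_vectorD (R : realType) (Omega : Type)
    (S : sublinear_space R Omega) (n : nat) (X Y : Omega -> 'rV[R]_n) :
  random_vector S X -> random_vector S Y -> random_vector S (fun w => X w + Y w).
Proof.
move=> hX hY j; have := sl_H_add (hX j) (hY j).
by congr sl_H; apply/funext => w; rewrite mxE.
Qed.

Lemma random_vector_sum (R : realType) (Omega : Type)
    (S : sublinear_space R Omega) (n : nat) (Y : nat -> Omega -> 'rV[R]_n)
    (k : nat) :
  (forall i, random_vector S (Y i)) ->
  random_vector S (fun w => \sum_(i < k) Y i w).
Proof.
move=> hY; elim: k => [|k ih] j.
  by under eq_fun do rewrite big_ord0 mxE; exact: sl_H_cst.
under eq_fun do rewrite big_ord_recr /=.
exact: random_vectorD.
Qed.

Lemma quad_lipschitz_enorm (R : realType) (n : nat) :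
  quad_lipschitz (@enorm R n).
Proof.
exists 1 => // x y; rewrite mul1r.
have h : `|enorm x - enorm y| <= enorm (x - y).
  rewrite ler_norml; have := enormDB y x 0; have := enormDB x y 0.
  rewrite !subr0 (enormB y x); lra.
rewrite (le_trans h) // ler_peMl ?enorm_ge0 //.
by rewrite -addrA lerDl addr_ge0 ?enorm_ge0.
Qed.

(** Ensures that the inner expectation produced by independence is again in [sl_H] when evaluated at
    a random vector, so that monotonicity applies to it. The increment of [f] is bounded by an
    expression affine in [|Y|], so taking expectations leaves only the first moment [m]. *)
Lemma quad_lipschitz_expect (R : realType) (Omega : Type)
    (S : sublinear_space R Omega) (n : nat) (f : 'rV[R]_n -> R)
    (Y : Omega -> 'rV[R]_n) :
  quad_lipschitz f -> random_vector S Y ->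
  quad_lipschitz (fun x => sl_E S (fun w => f (x + Y w))).
Proof.
move=> /[dup] qf [C C0 h] hY; set m := sl_E S (fun w => enorm (Y w)).
have HY : sl_H S (fun w => enorm (Y w)).
  exact: quad_lipschitz_H (quad_lipschitz_enorm _ _) hY.
have m0 : 0 <= m.
  rewrite -(sl_E_cst S 0); apply: sl_E_monotone => // [|w].
    exact: sl_H_cst.
  exact: enorm_ge0.
have Hf x : sl_H S (fun w => f (x + Y w)).
  by apply: quad_lipschitz_H => //; apply: random_vectorD => //; exact: random_vector_cst.
exists (C * (1 + 2 * m)) => [|x y]; first by rewrite mulr_ge0 // addr_ge0 // mulr_ge0.
have le x' y' : sl_E S (fun w => f (x' + Y w)) - sl_E S (fun w => f (y' + Y w)) <=
   C * (1 + 2 * m) * (1 + enorm x' + enorm y') * enorm (x' - y').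
  have ex := enorm_ge0 x'; have ey := enorm_ge0 y'; have exy := enorm_ge0 (x' - y').
  set a := 2 * C * enorm (x' - y').
  have a0 : 0 <= a by rewrite !mulr_ge0.
  set b := C * (1 + enorm x' + enorm y') * enorm (x' - y').
  have hle : sl_E S (fun w => f (x' + Y w)) <=
      sl_E S (fun w => f (y' + Y w)) + sl_E S (fun w => a * enorm (Y w) + b).
    apply: sl_E_leD => // [|w].
      by apply: sl_H_add; [exact: sl_H_scale|exact: sl_H_cst].
    rewrite -lerBlDl (le_trans (ler_norm _)) // (le_trans (h _ _)) //.
    have -> : x' + Y w - (y' + Y w) = x' - y' by rewrite opprD addrACA subrr addr0.
    rewrite /a /b; have := enormD x' (Y w); have := enormD y' (Y w).
    have -> : 2 * C * enorm (x' - y') * enorm (Y w) +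
      C * (1 + enorm x' + enorm y') * enorm (x' - y') =
      C * (1 + (enorm x' + enorm (Y w)) + (enorm y' + enorm (Y w))) *
        enorm (x' - y') by ring.
    by move=> hy hx; rewrite ler_wpM2r // ler_wpM2l // lerD // lerD2l.
  have hb : sl_E S (fun w => a * enorm (Y w) + b) <= a * m + b.
    rewrite -(sl_E_poshom a0 HY); apply: sl_E_leDc => //.
      by apply: sl_H_add; [exact: sl_H_scale|exact: sl_H_cst].
    exact: sl_H_scale.
  rewrite lerBlDl (le_trans hle) // lerD2l (le_trans hb) // -subr_ge0.
  have -> : C * (1 + 2 * m) * (1 + enorm x' + enorm y') * enorm (x' - y') -
     (a * m + b) = 2 * m * C * (enorm x' + enorm y') * enorm (x' - y').
    by rewrite /a /b; ring.
  by rewrite !mulr_ge0 // addr_ge0.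
rewrite ler_norml le //= andbT lerNl opprB (le_trans (le _ _)) //.
by rewrite (enormB y x) addrAC.
Qed.

(** * Independence applied to partial sums *)

Lemma prefix_vector_sum (R : realType) (Omega : Type) (d : nat) (k : nat) :
  exists A : 'M[R]_(k * d, d), forall (Y : nat -> Omega -> 'rV[R]_d) w,
    prefix_vector Y k w *m A = \sum_(i < k) Y i w.
Proof.
(* Multiplying the unflattened matrix on the left by the all-ones row adds its rows. *)
exists (lin_mul_row (const_mx 1)) => Y w.
rewrite mul_vec_lin_row; apply/rowP => j; rewrite mxE summxE.
by apply: eq_bigr => i _; rewrite !mxE mul1r.
Qed.

(* For k = 0, where independence is not assumed, the outer variable is constant. *)
Lemma sl_E_sum_recr (R : realType) (Omega : Type)
    (S : sublinear_space R Omega) (d : nat) (Y : nat -> Omega -> 'rV[R]_d)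
    (f : 'rV[R]_d -> R) (k : nat) :
  (forall i, (1 <= i)%N -> independent_from S (Y i) (prefix_vector Y i)) ->
  quad_lipschitz f ->
  sl_E S (fun w => f (\sum_(i < k.+1) Y i w)) =
  sl_E S (fun w => sl_E S (fun w' => f (\sum_(i < k) Y i w + Y k w'))).
Proof.
move=> ind qf; case: k => [|k].
  under eq_fun do rewrite big_ord_recr big_ord0 /=.
  under [in RHS]eq_fun do under eq_fun do rewrite big_ord0.
  by rewrite sl_E_cst.
have [A AY] := @prefix_vector_sum R Omega d k.+1.
(* On the pair (prefix, next vector) the stacked matrix computes the partial sum plus the next
   vector. *)
have := ind k.+1 isT (fun z => f (z *m col_mx A 1%:M)).
have qA := quad_lipschitz_poly (quad_lipschitz_mulmx (col_mx A 1%:M) qf).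
move=> /(_ qA); under eq_fun do rewrite mul_row_col mulmx1 AY.
under [in X in _ = X -> _]eq_fun do under eq_fun do rewrite mul_row_col mulmx1 AY.
by under [in X in _ -> X = _]eq_fun do rewrite big_ord_recr /=.
Qed.

(** * Sets of means and one-step estimates *)

Lemma dist_to_set1 (R : realType) (n : nat) (x a : 'rV[R]_n) :
  dist_to x [set a] = enorm (x - a).
Proof. by rewrite /dist_to image_set1 inf1. Qed.

Lemma quad_lipschitz_enorm_sq (R : realType) (n : nat) (a : 'rV[R]_n) :
  quad_lipschitz (fun x => enorm (x - a) ^+ 2).
Proof.
have := @quad_lipschitz_dist_sq R n [set a] (ex_intro _ a erefl).
by under eq_fun do rewrite dist_to_set1.
Qed.

Lemma quad_lipschitz_inner (R : realType) (n : nat) (p : 'rV[R]_n) :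
  quad_lipschitz (fun x => inner x p).
Proof.
exists (enorm p) => [|x y]; first exact: enorm_ge0.
rewrite -innerNl -innerDl.
have h : `|inner (x - y) p| <= enorm p * enorm (x - y).
  rewrite ler_norml lerNl -innerNl mulrC inner_le_enorm andbT.
  by rewrite -(enormN (x - y)) inner_le_enorm.
rewrite (le_trans h) // ler_wpM2r ?enorm_ge0 // ler_peMr ?enorm_ge0 //.
by rewrite -addrA lerDl addr_ge0 ?enorm_ge0.
Qed.

(** The right-hand side is the support function of [G], which thus acts as the set of possible means
    of [Y]. *)
Definition mean_set (R : realType) (Omega : Type) (S : sublinear_space R Omega)
    (d : nat) (Y : Omega -> 'rV[R]_d) (G : set 'rV[R]_d) : Prop :=
  forall p, sl_E S (fun w => inner (Y w) p) = sup [set inner q p | q in G].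

Lemma mean_set_le (R : realType) (Omega : Type) (S : sublinear_space R Omega)
    (d : nat) (Y : Omega -> 'rV[R]_d) (G : set 'rV[R]_d) (q p : 'rV[R]_d) :
  mean_set S Y G -> bounded_set G -> G q ->
  inner q p <= sl_E S (fun w => inner (Y w) p).
Proof.
move=> -> /bounded_setP[K GK] Gq; apply: ub_le_sup; last by exists q.
exists (K * enorm p) => _ [r Gr <-]; rewrite (le_trans (inner_le_enorm _ _)) //.
by rewrite ler_wpM2r ?enorm_ge0 // GK.
Qed.

(** Testing with [p = q] gives [|q|^2 <= E<Y, q>], and the right side is at most
    [(E|Y|^2 + |q|^2) / 2]. *)
Lemma mean_set_bound (R : realType) (Omega : Type) (S : sublinear_space R Omega)
    (d : nat) (Y : Omega -> 'rV[R]_d) (G : set 'rV[R]_d) (M : R)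
    (q : 'rV[R]_d) :
  random_vector S Y -> sl_E S (fun w => enorm (Y w) ^+ 2) <= M ->
  mean_set S Y G -> bounded_set G -> G q -> enorm q ^+ 2 <= M.
Proof.
move=> hY hM mG bG Gq.
have HY2 : sl_H S (fun w => enorm (Y w) ^+ 2).
  have := quad_lipschitz_H (quad_lipschitz_enorm_sq 0) hY.
  by under eq_fun do rewrite subr0.
have h1 := mean_set_le q mG bG Gq.
have h2 : sl_E S (fun w => inner (Y w) q) <=
    2^-1 * sl_E S (fun w => enorm (Y w) ^+ 2) + 2^-1 * enorm q ^+ 2.
  rewrite -sl_E_poshom //; apply: sl_E_leDc => [||w].
  - exact: quad_lipschitz_H (quad_lipschitz_inner q) hY.
  - exact: sl_H_scale.
  - by have := inner_ge0 (Y w - q); rewrite !innerE (innerC q) -!enorm_sq; lra.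
move: h1; rewrite -enorm_sq; lra.
Qed.

(** From [|Y - q|^2 <= 2 |Y|^2 + 2 |q|^2], where each of the two terms contributes at most [2 M]. *)
Lemma mean_set_variance (R : realType) (Omega : Type)
    (S : sublinear_space R Omega) (d : nat) (Y : Omega -> 'rV[R]_d)
    (G : set 'rV[R]_d) (M : R) (q : 'rV[R]_d) :
  random_vector S Y -> sl_E S (fun w => enorm (Y w) ^+ 2) <= M ->
  mean_set S Y G -> bounded_set G -> G q ->
  sl_E S (fun w => enorm (Y w - q) ^+ 2) <= 4 * M.
Proof.
move=> hY hM mG bG Gq; have qM := mean_set_bound hY hM mG bG Gq.
have HY2 : sl_H S (fun w => enorm (Y w) ^+ 2).
  have := quad_lipschitz_H (quad_lipschitz_enorm_sq 0) hY.
  by under eq_fun do rewrite subr0.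
suff h : sl_E S (fun w => enorm (Y w - q) ^+ 2) <=
    2 * sl_E S (fun w => enorm (Y w) ^+ 2) + 2 * enorm q ^+ 2 by lra.
rewrite -sl_E_poshom //; apply: sl_E_leDc => [||w].
- exact: quad_lipschitz_H (quad_lipschitz_enorm_sq q) hY.
- exact: sl_H_scale.
- have := inner_ge0 (Y w + q); rewrite !enorm_sq !innerE (innerC q); lra.
Qed.

Definition minkowski_sum (R : realType) (d : nat) (A B : set 'rV[R]_d) :
  set 'rV[R]_d := [set a + b | a in A & b in B].

(** A nearly optimal [q] depends on [x] through [u = x - a]; this is why the distance to the whole
    Minkowski sum is followed rather than the distance to one point. *)
Lemma dist_sq_step (R : realType) (Omega : Type)
    (S : sublinear_space R Omega) (d : nat) (Y : Omega -> 'rV[R]_d)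
    (A G : set 'rV[R]_d) (M : R) (x : 'rV[R]_d) :
  random_vector S Y -> sl_E S (fun w => enorm (Y w) ^+ 2) <= M ->
  mean_set S Y G -> bounded_set G -> G !=set0 -> A !=set0 ->
  sl_E S (fun w => dist_to (x + Y w) (minkowski_sum A G) ^+ 2) <=
  dist_to x A ^+ 2 + 4 * M.
Proof.
move=> hY hM mG bG /[dup] G0 [q0 Gq0] A0.
have AG0 : minkowski_sum A G !=set0.
  by case: A0 => a Aa; exists (a + q0), a => //; exists q0.
set E := sl_E _ _.
have Ea a : A a -> E <= enorm (x - a) ^+ 2 + 4 * M.
  move=> Aa; set u := x - a; set s := sl_E S (fun w => inner (Y w) u).
  have Eq q : G q -> E <= (2 * s + (enorm u ^+ 2 - 2 * inner q u)) + 4 * M.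
    move=> Gq; apply: (@le_trans _ _ (
      sl_E S (fun w => 2 * inner (Y w) u + (enorm u ^+ 2 - 2 * inner q u)) +
      sl_E S (fun w => enorm (Y w - q) ^+ 2))).
      apply: sl_E_leD => [|||w].
      - apply: (quad_lipschitz_H (quad_lipschitz_dist_sq AG0)).
        by apply: random_vectorD => //; exact: random_vector_cst.
      - apply: sl_H_add; last exact: sl_H_cst.
        by apply: sl_H_scale; exact: quad_lipschitz_H (quad_lipschitz_inner u) hY.
      - exact: quad_lipschitz_H (quad_lipschitz_enorm_sq q) hY.
      (* The distance to the set is at most the distance to [a + q], whose square expands exactly
         around [u]. *)
      - have AGaq : minkowski_sum A G (a + q) by exists a => //; exists q.
        have -> : 2 * inner (Y w) u + (enorm u ^+ 2 - 2 * inner q u) +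
            enorm (Y w - q) ^+ 2 = enorm (x + Y w - (a + q)) ^+ 2.
          rewrite opprD addrACA -/u; move: (u) => v; rewrite !enorm_sq !innerE.
          by rewrite (innerC v (Y w)) (innerC v q) (innerC q (Y w)); ring.
        rewrite ler_pXn2r ?nnegrE ?enorm_ge0 ?dist_to_ge0 //.
        exact: dist_to_le.
    apply: lerD; last exact: mean_set_variance hM mG bG Gq.
    rewrite /s -sl_E_poshom //; last first.
      exact: quad_lipschitz_H (quad_lipschitz_inner u) hY.
    have HX : sl_H S (fun w => 2 * inner (Y w) u).
      by apply: sl_H_scale; exact: quad_lipschitz_H (quad_lipschitz_inner u) hY.
    by apply: sl_E_leDc => //; apply: sl_H_add => //; exact: sl_H_cst.
  (* Taking the supremum over q in G turns <q, u> into s. *)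
  suff : s <= (2 * s + enorm u ^+ 2 + 4 * M - E) / 2 by lra.
  rewrite {1}/s mG; apply: ge_sup; first by exists (inner q0 u), q0.
  by move=> _ [q /Eq + <-]; lra.
(* To pass to the infimum over [a]: if [z = E - 4 M] is positive, its square root bounds every
   [|x - a|] from below, hence also the distance. *)
rewrite -lerBlDr; set z := _ - _.
have [z0|z0] := leP z 0; first by rewrite (le_trans z0) ?sqr_ge0.
rewrite -(sqr_sqrtr (ltW z0)) ler_pXn2r ?nnegrE ?sqrtr_ge0 ?dist_to_ge0 //.
apply: dist_to_ge => // a /Ea; rewrite -lerBlDr -/z => h.
by rewrite -[leRHS](ger0_norm (enorm_ge0 _)) -sqrtr_sqr ler_wsqrtr.
Qed.

(** Sub-additivity only bounds expectations of sums from above, so the identity for the square is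
    solved for [2 <Y, u>]; its expectation is at least [2 <q, u>], which leaves the lower bound.
    Here [u = a - x], opposite to the sign used for the distance. *)
Lemma enorm_sq_step (R : realType) (Omega : Type)
    (S : sublinear_space R Omega) (d : nat) (Y : Omega -> 'rV[R]_d)
    (G : set 'rV[R]_d) (M : R) (x a q : 'rV[R]_d) :
  random_vector S Y -> sl_E S (fun w => enorm (Y w) ^+ 2) <= M ->
  mean_set S Y G -> bounded_set G -> G q ->
  - enorm (x - a) ^+ 2 <=
  sl_E S (fun w => - enorm (x + Y w - (a + q)) ^+ 2) + 4 * M.
Proof.
move=> hY hM mG bG Gq; set u := a - x.
have hs := mean_set_le u mG bG Gq.
have HX : sl_H S (fun w => inner (Y w) u).
  exact: quad_lipschitz_H (quad_lipschitz_inner u) hY.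
have h2 : 2 * sl_E S (fun w => inner (Y w) u) <=
    sl_E S (fun w => - enorm (x + Y w - (a + q)) ^+ 2 + (enorm u ^+ 2 + 2 * inner q u))
    + sl_E S (fun w => enorm (Y w - q) ^+ 2).
  have HZ : sl_H S (fun w => - enorm (x + Y w - (a + q)) ^+ 2).
    apply: sl_H_opp; apply: (quad_lipschitz_H (quad_lipschitz_enorm_sq _)).
    by apply: random_vectorD => //; exact: random_vector_cst.
  rewrite -sl_E_poshom //; apply: sl_E_leD => [|||w].
  - exact: sl_H_scale.
  - by apply: sl_H_add => //; exact: sl_H_cst.
  - exact: quad_lipschitz_H (quad_lipschitz_enorm_sq q) hY.
  - have -> : x + Y w - (a + q) = (Y w - q) - u.
      by rewrite /u opprD addrACA opprB addrC.
    move: (u) => v; rewrite !enorm_sq !innerE.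
    rewrite (innerC v (Y w)) (innerC v q) (innerC q (Y w)); lra.
have h3 : sl_E S (fun w => - enorm (x + Y w - (a + q)) ^+ 2 + (enorm u ^+ 2 + 2 * inner q u))
   <= sl_E S (fun w => - enorm (x + Y w - (a + q)) ^+ 2) + (enorm u ^+ 2 + 2 * inner q u).
  have HZ : sl_H S (fun w => - enorm (x + Y w - (a + q)) ^+ 2).
    apply: sl_H_opp; apply: (quad_lipschitz_H (quad_lipschitz_enorm_sq _)).
    by apply: random_vectorD => //; exact: random_vector_cst.
  by apply: sl_E_leDc => //; apply: sl_H_add => //; exact: sl_H_cst.
have := mean_set_variance hY hM mG bG Gq.
rewrite (enormB x a) -/u; lra.
Qed.

(** * Second-moment bounds for the partial sums *)

Fixpoint minkowski_partial_sum (R : realType) (d : nat)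
    (G : nat -> set 'rV[R]_d) (k : nat) : set 'rV[R]_d :=
  if k is k'.+1 then minkowski_sum (minkowski_partial_sum G k') (G k')
  else [set 0].

Lemma minkowski_partial_sum_neq0 (R : realType) (d : nat)
    (G : nat -> set 'rV[R]_d) (k : nat) :
  (forall i, G i !=set0) -> minkowski_partial_sum G k !=set0.
Proof.
move=> G0; elim: k => [|k [a Aa]]; first by exists 0.
by have [q Gq] := G0 k; exists (a + q), a => //; exists q.
Qed.

(** Induction on [k]: independence turns the last summand into an inner expectation, to which
    [dist_sq_step] applies pointwise with [x] the previous partial sum. *)
Lemma expect_dist_sq_sum (R : realType) (Omega : Type)
    (S : sublinear_space R Omega) (d : nat) (Y : nat -> Omega -> 'rV[R]_d)
    (G : nat -> set 'rV[R]_d) (M : R) (k : nat) :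
  (forall i, random_vector S (Y i)) ->
  (forall i, (1 <= i)%N -> independent_from S (Y i) (prefix_vector Y i)) ->
  (forall i, sl_E S (fun w => enorm (Y i w) ^+ 2) <= M) ->
  (forall i, mean_set S (Y i) (G i)) ->
  (forall i, bounded_set (G i)) -> (forall i, G i !=set0) ->
  sl_E S (fun w => dist_to (\sum_(i < k) Y i w) (minkowski_partial_sum G k) ^+ 2)
  <= k%:R * (4 * M).
Proof.
move=> hY ind hM mG bG G0; elim: k => [|k ih].
  under eq_fun do rewrite big_ord0 dist_to_set1 subrr enorm0.
  by rewrite sl_E_cst expr0n mul0r.
have A0 j : minkowski_partial_sum G j !=set0 by exact: minkowski_partial_sum_neq0.
have qA j := quad_lipschitz_dist_sq (A0 j).
rewrite (sl_E_sum_recr _ ind (qA k.+1)).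
rewrite -natr1 mulrDl mul1r (le_trans _ (lerD ih (lexx _))) //.
have HS := random_vector_sum k hY.
apply: sl_E_leDc => [||w].
- exact: (quad_lipschitz_H (quad_lipschitz_expect (qA k.+1) (hY k)) HS).
- exact: quad_lipschitz_H (qA k) HS.
- exact: dist_sq_step.
Qed.

Lemma expect_enorm_sq_sum (R : realType) (Omega : Type)
    (S : sublinear_space R Omega) (d : nat) (Y : nat -> Omega -> 'rV[R]_d)
    (G : nat -> set 'rV[R]_d) (M : R) (q : nat -> 'rV[R]_d) (k : nat) :
  (forall i, random_vector S (Y i)) ->
  (forall i, (1 <= i)%N -> independent_from S (Y i) (prefix_vector Y i)) ->
  (forall i, sl_E S (fun w => enorm (Y i w) ^+ 2) <= M) ->
  (forall i, mean_set S (Y i) (G i)) ->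
  (forall i, bounded_set (G i)) -> (forall i, G i (q i)) ->
  - (k%:R * (4 * M)) <=
  sl_E S (fun w => - enorm (\sum_(i < k) Y i w - \sum_(i < k) q i) ^+ 2).
Proof.
move=> hY ind hM mG bG Gq; elim: k => [|k ih].
  under eq_fun do rewrite !big_ord0 subrr enorm0 expr0n oppr0.
  by rewrite sl_E_cst mul0r oppr0.
have qA j := quad_lipschitz_opp (quad_lipschitz_enorm_sq (\sum_(i < j) q i)).
rewrite (sl_E_sum_recr _ ind (qA k.+1)).
rewrite -natr1 mulrDl mul1r opprD lerBlDr (le_trans ih) //.
have HS := random_vector_sum k hY.
apply: sl_E_leDc => [||w].
- exact: quad_lipschitz_H (qA k) HS.
- exact: (quad_lipschitz_H (quad_lipschitz_expect (qA k.+1) (hY k)) HS).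
- by rewrite big_ord_recr; apply: enorm_sq_step (Gq k).
Qed.

(** * The law of large numbers with an explicit error *)

Lemma minkowski_partial_sum_near (R : realType) (d : nat)
    (G : nat -> set 'rV[R]_d) (L : set 'rV[R]_d) (e : nat -> R) (k : nat)
    (a : 'rV[R]_d) :
  convex_in L -> (forall i q, G i q -> exists2 x, L x & enorm (q - x) <= e i) ->
  minkowski_partial_sum G k.+1 a ->
  exists2 b, L b & enorm (a - k.+1%:R *: b) <= \sum_(i < k.+1) e i.
Proof.
move=> cL GL; elim: k a => [|k ih] a [a' Aa' [q Gq <-]].
  have [x Lx qx] := GL _ _ Gq; exists x => //.
  by rewrite big_ord_recr big_ord0 /= add0r scale1r Aa' add0r.
have [b Lb ab] := ih _ Aa'; have [x Lx qx] := GL _ _ Gq.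
(* The weight of a running average: [k.+2] times the new point is [k.+1] times [b] plus [x]. *)
pose t : R := k.+1%:R / k.+2%:R.
have t01 : 0 <= t <= 1.
  by rewrite divr_ge0 //= ler_pdivrMr // mul1r ler_nat.
exists (t *: b + (1 - t) *: x); first exact: (convex_inP L).1.
have -> : a' + q - k.+2%:R *: (t *: b + (1 - t) *: x) =
    (a' - k.+1%:R *: b) + (q - x).
  rewrite scalerDr !scalerA mulrBr mulr1 /t mulrCA divff ?pnatr_eq0 // mulr1.
  by rewrite -natrB ?leqnSn // subSnn scale1r opprD addrACA.
rewrite big_ord_recr /= (le_trans (enormD _ _)) //; exact: lerD.
Qed.

(** Young's inequality. It lets second moments control first-order deviations, at the price of the
    free parameter [eta]. *)
Lemma le_add_sq_div (R : realType) (t eta : R) :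
  0 < eta -> t <= eta + t ^+ 2 / eta.
Proof.
move=> e0; rewrite -lerBlDl ler_pdivlMr //.
by have := sqr_ge0 (t - eta / 2); have := sqr_ge0 eta; nra.
Qed.

(** The three error terms are the Cesaro mean of the set distances, the price of Young's inequality,
    and the second-moment bound [4 M n] after division by [n^2 eta]. *)
Lemma expect_mean_bounds (R : realType) (Omega : Type)
    (S : sublinear_space R Omega) (d : nat) (Y : nat -> Omega -> 'rV[R]_d)
    (G : nat -> set 'rV[R]_d) (L : set 'rV[R]_d) (M : R) (e : nat -> R)
    (phi : 'rV[R]_d -> R) (C v eta : R) (n : nat) :
  (forall i, random_vector S (Y i)) ->
  (forall i, (1 <= i)%N -> independent_from S (Y i) (prefix_vector Y i)) ->
  (forall i, sl_E S (fun w => enorm (Y i w) ^+ 2) <= M) ->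
  (forall i, mean_set S (Y i) (G i)) ->
  (forall i, bounded_set (G i)) -> (forall i, G i !=set0) ->
  convex_in L -> (forall i q, G i q -> exists2 x, L x & enorm (q - x) <= e i) ->
  (forall i x, L x -> exists2 q, G i q & enorm (x - q) <= e i) ->
  bounded_lipschitz phi -> 0 < C ->
  (forall x y, `|phi x - phi y| <= C * enorm (x - y)) ->
  is_max [set phi y | y in L] v -> 0 < eta ->
  `|sl_E S (fun w => phi (mean Y n.+1 w)) - v| <=
  C * (n.+1%:R^-1 * (\sum_(i < n.+1) e i) + eta + 4 * M / (n.+1%:R * eta)).
Proof.
move=> hY ind hM mG bG G0 cL GL LG bphi C0 lip [[y Ly phiy] vub] eta0.
move NE : (n.+1%:R : R) => N; have N0 : 0 < N by rewrite -NE.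
set se := \sum_(i < n.+1) e i.
have HS := random_vector_sum n.+1 hY.
have Hphi : sl_H S (fun w => phi (mean Y n.+1 w)).
  exact: (quad_lipschitz_H (bounded_lipschitz_quad n.+1%:R^-1 bphi) HS).
(* The coefficient of [t ^+ 2] when Young's inequality is applied to [t / N] and multiplied by
   [C]. *)
set r := C / (N ^+ 2 * eta).
have r0 : 0 <= r by rewrite divr_ge0 ?mulr_ge0 ?sqr_ge0 // ltW.
have young t : C * (t / N) <= r * t ^+ 2 + C * eta.
  have -> : r * t ^+ 2 + C * eta = C * (eta + (t / N) ^+ 2 / eta).
    by rewrite /r; field; rewrite !gt_eqF.
  by rewrite ler_pM2l // le_add_sq_div.
have rM : r * (N * (4 * M)) = C * (4 * M / (N * eta)).
  by rewrite /r; field; rewrite !gt_eqF.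
have scaled x b : enorm (N^-1 *: x - b) = enorm (x - N *: b) / N.
  have -> : N^-1 *: x - b = N^-1 *: (x - N *: b).
    by rewrite scalerBr scalerA mulVf ?gt_eqF // scale1r.
  by rewrite enormZ ger0_norm ?invr_ge0 ?ltW // mulrC.
have lipl x b : phi x <= phi b + C * enorm (x - b).
  by rewrite -lerBlDl (le_trans _ (lip x b)) // ler_norm.
rewrite ler_norml lerBrDr lerBlDr; apply/andP; split.
  (* Lower bound: the maximizer [y] is approximated in each [G i], and the sum [c] of these points
     is compared with [N *: y]. *)
  have /choice[q qP] : forall i, exists q, G i q /\ enorm (y - q) <= e i.
    by move=> i; have [q] := LG i y Ly; exists q.
  have Gq i : G i (q i) by have [] := qP i.
  have low := expect_enorm_sq_sum n.+1 hY ind hM mG bG Gq.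
  rewrite NE in low; set c := \sum_(i < n.+1) q i in low.
  have cy : enorm (c - N *: y) <= se.
    have -> : c - N *: y = \sum_(i < n.+1) (q i - y).
      by rewrite sumrB sumr_const card_ord -NE scaler_nat.
    rewrite (le_trans (enorm_sum _ _)) //; apply: ler_sum => i _.
    by rewrite enormB; have [] := qP i.
  have HD : sl_H S (fun w => - enorm (\sum_(i < n.+1) Y i w - c) ^+ 2).
    exact: quad_lipschitz_H (quad_lipschitz_opp (quad_lipschitz_enorm_sq c)) HS.
  have := @sl_E_leDc _ _ S (fun w => r * - enorm (\sum_(i < n.+1) Y i w - c) ^+ 2)
     (fun w => phi (mean Y n.+1 w)) (C * (N^-1 * se + eta) - v) (sl_H_scale r HD) Hphi.
  rewrite sl_E_poshom // => h.
  have : r * sl_E S (fun w => - enorm (\sum_(i < n.+1) Y i w - c) ^+ 2) <=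
      sl_E S (fun w => phi (mean Y n.+1 w)) + (C * (N^-1 * se + eta) - v).
    apply: h => w; rewrite /mean NE; set x := \sum_(i < n.+1) Y i w.
    have := lipl y (N^-1 *: x); rewrite phiy enormB scaled => h1.
    have := young (enorm (x - c)).
    have : C * (enorm (x - N *: y) / N) <= C * (enorm (x - c) / N + N^-1 * se).
      rewrite ler_pM2l // [N^-1 * _]mulrC -mulrDl ler_pM2r ?invr_gt0 //.
      by rewrite (le_trans (enormDB c x _)) // lerD2l.
    lra.
  by have := ler_wpM2l r0 low; rewrite mulrN rM; lra.
(* Upper bound: every point of [A] is close to [N] times a point of [L], where [phi] is at most
   [v]. *)
pose A := minkowski_partial_sum G n.+1.
have A0 : A !=set0 by exact: minkowski_partial_sum_neq0.
have := expect_dist_sq_sum n.+1 hY ind hM mG bG G0; rewrite NE => upp.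
have HD := quad_lipschitz_H (quad_lipschitz_dist_sq A0) HS.
have : sl_E S (fun w => phi (mean Y n.+1 w)) <=
    r * sl_E S (fun w => dist_to (\sum_(i < n.+1) Y i w) A ^+ 2) +
    (v + C * (N^-1 * se + eta)).
  rewrite -sl_E_poshom //; apply: sl_E_leDc => // [|w]; first exact: sl_H_scale.
  rewrite /mean NE; set x := \sum_(i < n.+1) Y i w.
  (* The wanted bound on [phi] is solved for [dist_to x A], so that it can be checked at each point
     [a] of [A] without a nearest one. *)
  have : (phi (N^-1 *: x) - v - C * (N^-1 * se)) * N / C <= dist_to x A.
    apply: dist_to_ge => // a Aa.
    have [b Lb] := minkowski_partial_sum_near cL GL Aa; rewrite NE => ab.
    rewrite ler_pdivrMr // -ler_pdivlMr // lerBlDr lerBlDr.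
    rewrite (le_trans (lipl _ b)) // scaled addrC lerD //; last first.
      by apply: vub; exists b.
    have -> : enorm (x - a) * C / N + C * (N^-1 * se) = C * ((enorm (x - a) + se) / N).
      by field; rewrite gt_eqF.
    rewrite ler_pM2l // ler_pM2r ?invr_gt0 //.
    by rewrite (le_trans (enormDB a x _)) // lerD2l.
  rewrite ler_pdivrMr // -ler_pdivlMr // lerBlDr lerBlDr => h.
  have := young (dist_to x A).
  have -> : C * (dist_to x A / N) = dist_to x A * C / N by ring.
  lra.
by have := ler_wpM2l r0 upp; rewrite rM; lra.
Qed.

(** * Existence of the maximal distribution *)

(** The canonical model: the sample space is the Euclidean space itself, [eta] is the identity and
    [E] is the supremum over [L], attained by compactness when [phi] is bounded Lipschitz. It shows
    that quantifying over all maximal distributed [eta] is not vacuous. *)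
Lemma maximal_space_exists (R : realType) (d : nat) (L : set 'rV[R]_d) :
  nonempty_bounded_closed L ->
  exists (Omega : Type) (S : sublinear_space R Omega) (eta : Omega -> 'rV[R]_d),
    maximal_distributed S L eta.
Proof.
move=> [[y0 Ly0] bL cL].
(* Boundedness on L is all that is required of a random variable: it makes the
   supremum E finite and is preserved by locally Lipschitz functions. *)
pose H := [set X : 'rV[R]_d -> R | exists K, forall y, L y -> `|X y| <= K].
pose E (X : 'rV[R]_d -> R) := sup [set X y | y in L].
have HE X y : H X -> L y -> X y <= E X.
  move=> [K XK] Ly; apply: ub_le_sup; last by exists y.
  by exists K => _ [z Lz <-]; rewrite (le_trans (ler_norm _)) // XK.
have EH X c : (forall y, L y -> X y <= c) -> E X <= c.
  move=> h; apply: ge_sup; first by exists (X y0), y0.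
  by move=> _ [y Ly <-]; exact: h.
have Hcst c : H (fun=> c) by exists `|c|.
have Hadd X Y : H X -> H Y -> H (fun w => X w + Y w).
  move=> [K XK] [K' YK]; exists (K + K') => y Ly.
  by rewrite (le_trans (ler_normD _ _)) // lerD // ?XK ?YK.
have Hscale a X : H X -> H (fun w => a * X w).
  move=> [K XK]; exists (`|a| * K) => y Ly.
  by rewrite normrM ler_wpM2l // XK.
have Habs X : H X -> H (fun w => `|X w|).
  by move=> [K XK]; exists K => y Ly; rewrite normr_id XK.
have Hcomp n (phi : 'rV[R]_n -> R) (X : 'rV[R]_d -> 'rV[R]_n) :
    locally_lipschitz_poly phi -> coordinates_in H X -> H (fun w => phi (X w)).
  move=> [C [m [C0 lip]]] /choice[K XK].
  pose B := \sum_(j < n) K j.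
  exists (C * (1 + B ^+ m + enorm (0 : 'rV[R]_n) ^+ m) * B + `|phi 0|) => y Ly.
  have XB : enorm (X y) <= B.
    by rewrite (le_trans (enorm_le_sum _)) //; apply: ler_sum => j _; exact: XK.
  rewrite -[phi _](subrK (phi 0)) (le_trans (ler_normD _ _)) // lerD2r.
  rewrite (le_trans (lip _ _)) // subr0; apply: ler_pM => //.
  - by rewrite mulr_ge0 ?(ltW C0) // !addr_ge0 // exprn_ge0 // enorm_ge0.
  - exact: enorm_ge0.
  - rewrite ler_pM2l // lerD2r lerD2l lerXn2r ?nnegrE ?enorm_ge0 //.
    exact: le_trans (enorm_ge0 _) XB.
have Emono X Y : H X -> H Y -> (forall w, Y w <= X w) -> E Y <= E X.
  by move=> HX _ YX; apply: EH => y Ly; rewrite (le_trans (YX y)) // HE.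
have Ecst c : E (fun=> c) = c.
  by apply/le_anti; rewrite EH //=; apply: (HE (fun=> c) y0).
have Esub X Y : H X -> H Y -> E (fun w => X w + Y w) <= E X + E Y.
  by move=> HX HY; apply: EH => y Ly; rewrite lerD ?HE.
have Ehom (a : R) X : 0 <= a -> H X -> E (fun w => a * X w) = a * E X.
  rewrite le0r => /orP[/eqP-> _|a0 HX].
    by rewrite mul0r; under [X in E X]eq_fun do rewrite mul0r.
  apply/le_anti/andP; split.
    by apply: EH => y Ly; rewrite ler_pM2l // HE.
  rewrite mulrC -ler_pdivlMr //; apply: EH => y Ly.
  rewrite ler_pdivlMr // mulrC; apply: (HE (fun w => a * X w)) => //.
  exact: Hscale.
pose S := SublinearSpace Hcst Hadd Hscale Habs Hcomp Emono Ecst Esub Ehom.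
exists 'rV[R]_d, S, id; split.
  move=> j /=; have /bounded_setP[K LK] := bL; exists K => y Ly.
  by rewrite (le_trans (coord_le_enorm _ _)) // LK.
move=> phi [[K phiK] [C lip]] /=.
have cphi : {within L, continuous phi}.
  apply: continuous_subspaceT => x.
  apply/(@cvgrPdist_lt _ _ _ _ (nbhs_filter (x : 'rV[R]_d))) => e e0.
  have C0 : 0 < `|C| + 1 by rewrite ltr_wpDl.
  apply: filterS (nbhs_enorm x (divr_gt0 e0 C0)) => z /= xz.
  rewrite (le_lt_trans (lip x z)) //; rewrite ltr_pdivlMr // mulrC in xz.
  rewrite (le_lt_trans _ xz) // ler_wpM2r ?enorm_ge0 //.
  by rewrite (le_trans (ler_norm _)) // lerDl.
have [y] := compact_EVT_max (ex_intro _ y0 Ly0) (bounded_closed_compact bL cL) cphi.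
rewrite inE => Ly ymax.
have Hphi : H phi by exists K.
have Ephi : E phi = phi y.
  apply/le_anti; rewrite HE // andbT; apply: EH => z Lz; apply: ymax.
  by rewrite inE.
split; first by exists y; rewrite ?Ephi.
by move=> _ [z Lz <-]; exact: HE.
Qed.

(** * Convergence in law *)

Lemma mean_converges_in_law (R : realType) (Omega : Type)
    (S : sublinear_space R Omega) (d : nat) (Y : nat -> Omega -> 'rV[R]_d)
    (G : nat -> set 'rV[R]_d) (L : set 'rV[R]_d) (M : R)
    (phi : 'rV[R]_d -> R) (v : R) :
  (forall i, random_vector S (Y i)) ->
  (forall i, (1 <= i)%N -> independent_from S (Y i) (prefix_vector Y i)) ->
  (forall i, sl_E S (fun w => enorm (Y i w) ^+ 2) <= M) ->
  (forall i, mean_set S (Y i) (G i)) ->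
  (forall i, nonempty_bounded_closed (G i)) ->
  nonempty_bounded_closed L -> convex_in L ->
  (fun i => hausdorff_dist L (G i)) @ \oo --> (0 : R) ->
  bounded_lipschitz phi -> is_max [set phi y | y in L] v ->
  (fun n => sl_E S (fun w => phi (mean Y n w))) @ \oo --> v.
Proof.
move=> hY ind hM mG nbcG [L0 bL _] cL dLG bphi vmax.
have G0 i : G i !=set0 by have [] := nbcG i.
have bG i : bounded_set (G i) by have [] := nbcG i.
(* The harmonic term makes the inequality strict, as [dist_to_lt] requires to produce a point, and
   it still tends to 0. *)
pose e i := hausdorff_dist L (G i) + harmonic i.
have he i : hausdorff_dist L (G i) < e i by rewrite /e ltrDl harmonic_gt0.
have e0 : arithmetic_mean e @ \oo --> (0 : R).
  by apply: cesaro; rewrite -[0]addr0; apply: cvgD => //; exact: cvg_harmonic.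
have GL i q : G i q -> exists2 x, L x & enorm (q - x) <= e i.
  move=> Gq; have := dist_to_le_hausdorff (bG i) L0 Gq.
  rewrite hausdorff_distC => /le_lt_trans/(_ (he i))/(dist_to_lt L0)[x Lx qx].
  by exists x => //; exact: ltW.
have LG i x : L x -> exists2 q, G i q & enorm (x - q) <= e i.
  move=> /(dist_to_le_hausdorff bL (G0 i)).
  move=> /le_lt_trans/(_ (he i))/(dist_to_lt (G0 i))[q Gq xq].
  by exists q => //; exact: ltW.
have [_ [C0 lip0]] := bphi.
(* The given Lipschitz constant has no prescribed sign; a positive one is needed to divide by. *)
pose C := `|C0| + 1.
have Cgt0 : 0 < C by rewrite /C ltr_wpDl.
have lip x y : `|phi x - phi y| <= C * enorm (x - y).
  rewrite (le_trans (lip0 x y)) // ler_wpM2r ?enorm_ge0 //.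
  by rewrite (le_trans (ler_norm _)) // lerDl.
(* The shift discards [n = 0], where [mean] takes its default value 0. *)
rewrite -cvg_shiftS; apply/cvgrPdist_le => eps eps0.
(* Each of the three error terms will be at most [eta], and [C] times their sum at most [eps]. *)
pose eta := eps / (3 * C).
have eta0 : 0 < eta by rewrite divr_gt0 // mulr_gt0.
have h0 : (fun n => 4 * M / eta * harmonic n) @ \oo --> (0 : R).
  by rewrite -[X in _ --> X](mulr0 (4 * M / eta)); apply: cvgMr; exact: cvg_harmonic.
near=> n.
rewrite distrC (le_trans (expect_mean_bounds n hY ind hM mG bG G0 cL GL LG bphi
  Cgt0 lip vmax eta0)) //.
have en : n.+1%:R^-1 * (\sum_(i < n.+1) e i) <= eta.
  have : arithmetic_mean e n <= eta.
    by rewrite ltW //; near: n; exact: cvgr_lt e0 _ eta0.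
  by rewrite /arithmetic_mean /= /series /= big_mkord.
have hn : 4 * M / (n.+1%:R * eta) <= eta.
  have -> : 4 * M / (n.+1%:R * eta) = 4 * M / eta * harmonic n.
    by rewrite /harmonic /= invfM; ring.
  by rewrite ltW //; near: n; exact: cvgr_lt h0 _ eta0.
have -> : eps = C * (eta + eta + eta) by rewrite /eta; field; rewrite gt_eqF.
by rewrite ler_pM2l // !lerD.
Unshelve. all: by end_near. Qed.

(* Sequences are indexed from 0: [Y i] and [G i] stand for Y_{i+1} and
   Gamma_{i+1}. *)
Theorem corollary5p7 (R : realType) (d : nat) (Omega : Type)
  (S : sublinear_space R Omega)
  (Y : nat -> Omega -> 'rV[R]_d)
  (Y_rv : forall i : nat, random_vector S (Y i))
  (Y_indep : forall i : nat, (1 <= i)%N ->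
     independent_from S (Y i) (prefix_vector Y i))
  (M : R) (M_gt0 : 0 < M)
  (Y_moment2 : forall i : nat, sl_E S (fun w => enorm (Y i w) ^+ 2) <= M)
  (G : nat -> set 'rV[R]_d)
  (G_convex : forall i : nat, convex_in (G i))
  (G_mean : forall (i : nat) (p : 'rV[R]_d),
     sl_E S (fun w => inner (Y i w) p) = sup [set inner q p | q in G i])
  (G_cauchy : hausdorff_cauchy G) :
  exists G_lim : set 'rV[R]_d,
    [/\ nonempty_bounded_closed G_lim,
        convex_in G_lim,
        (fun i => hausdorff_dist G_lim (G i)) @ \oo --> (0 : R),
        exists (Omega' : Type) (S' : sublinear_space R Omega')
               (eta : Omega' -> 'rV[R]_d), maximal_distributed S' G_lim eta
      & forall (Omega' : Type) (S' : sublinear_space R Omega')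
               (eta : Omega' -> 'rV[R]_d), maximal_distributed S' G_lim eta ->
          converges_in_law S S' (mean Y) eta].
Proof.
have Gnbc := G_cauchy.1.
have nbcL := limit_set_nbc G_cauchy.
have cL : convex_in (limit_set G).
  by apply: limit_set_convex G_convex => i; have [] := Gnbc i.
have dL := hausdorff_limit_set G_cauchy.
exists (limit_set G); split => //; first exact: maximal_space_exists.
(* Only the maximum of [phi] over the limit set is retained from [eta], so its space may be
   arbitrary. *)
move=> Omega' S' eta [_ eta_max] phi bphi.
exact: mean_converges_in_law Y_rv Y_indep Y_moment2 G_mean Gnbc nbcL cL dL bphi
  (eta_max _ bphi).
Qed.
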